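(* Let $R$ be a finite commutative ring with $1\neq 0$ such that $\gamma_a(\Gamma(R))=1$. Then the following statements are equivalent: (1) $\Gamma(R)$ is partitionable into global defensive alliances. (2) $|Z(R)|=3$. (3) $R$ is isomorphic to one of the rings $\mathbb{Z}_2\times \mathbb{Z}_2$, $\mathbb{Z}_9$, $\mathbb{Z}_3[X]/(X^2)$.
   Context: For a commutative ring $R$ with $1\neq 0$, $Z(R)$ denotes the set of zero-divisors of $R$ (including $0$), and $\mathbb{Z}_n=\mathbb{Z}/n\mathbb{Z}$. The zero-divisor graph $\Gamma(R)$ is the simple graph whose vertices are the nonzero zero-divisors of $R$, two distinct vertices $x,y$ being adjacent if and only if $xy=0$. Let $\Gamma=(V,E)$ be a finite simple graph. For $S\subseteq V$ put $\bar S=V\setminus S$ and $\deg_S(x)=|S\cap N(x)|$, where $N(x)$ is the set of vertices adjacent to $x$. A nonempty $S\subseteq V$ is a dominating set if $\deg_S(v)>0$ for every $v\in\bar S$; it is a defensive alliance if $\deg_S(x)+1\ge \deg_{\bar S}(x)$ for every $x\in S$; it is a global defensive alliance if it is both. The global defensive alliance partition number $\psi_g(\Gamma)$ is the maximum number of sets in a partition of $V$ such that each set is a global defensive alliance; $\Gamma$ is partitionable into global defensive alliances if $\psi_g(\Gamma)\ge 2$. The global defensive alliance number $\gamma_a(\Gamma)$ is the minimum cardinality of a global defensive alliance in $\Gamma$. *)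

(* Defs.v *)
From mathcomp Require Import all_boot all_algebra.

Set Implicit Arguments.
Unset Strict Implicit.
Unset Printing Implicit Defensive.

Import GRing.Theory.

Record sgraph := SGraph {
  vertex :> finType;
  adj : rel vertex;
  adj_sym : symmetric adj;
  adj_irrefl : irreflexive adj
}.

Section Alliances.
Variable G : sgraph.
Implicit Types (S : {set G}) (x : G).

Definition neighbours x : {set G} := [set y | adj x y].

Definition deg_in S x : nat := #|S :&: neighbours x|.

Definition dominating S : bool :=
  (S != set0) && [forall v in ~: S, 0 < deg_in S v].

Definition defensive_alliance S : bool :=
  (S != set0) && [forall x in S, deg_in (~: S) x <= deg_in S x + 1].

Definition global_defensive_alliance S : bool :=
  defensive_alliance S && dominating S.

Definition gda_partition (P : {set {set G}}) : bool :=
  partition P [set: G] && [forall S in P, global_defensive_alliance S].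

Definition gda_partition_number : nat :=
  \max_(P : {set {set G}} | gda_partition P) #|P|.

Definition gda_partitionable : bool := 2 <= gda_partition_number.

(* The default candidate [set: G] is a global defensive alliance as soon as G
   has a vertex.  The graph without vertices has no global defensive alliance,
   and its number is then 0 by convention. *)
Definition gda_number : nat :=
  #|[arg min_(S < [set: G] | global_defensive_alliance S) #|S| ]|.

End Alliances.

Local Open Scope ring_scope.

Section ZeroDivisorGraph.
Variable R : finComNzRingType.

Definition zero_divisors : {set R} :=
  [set x | [exists y : R, (y != 0) && (x * y == 0)]].

Definition zdg_vertex : finType := {x : R | x \in zero_divisors :\ 0}.

Definition zdg_adj : rel zdg_vertex :=
  fun x y => (x != y) && (val x * val y == 0).

Lemma zdg_adj_sym : symmetric zdg_adj.
Proof. by move=> x y; rewrite /zdg_adj eq_sym mulrC. Qed.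

Lemma zdg_adj_irrefl : irreflexive zdg_adj.
Proof. by move=> x; rewrite /zdg_adj eqxx. Qed.

Definition zero_divisor_graph : sgraph := SGraph zdg_adj_sym zdg_adj_irrefl.

End ZeroDivisorGraph.

Definition ring_isomorphic (R S : nzRingType) : Prop :=
  exists f : {rmorphism R -> S}, bijective f.

(* Main.v *)
Require Import Defs.
From mathcomp Require Import all_boot all_algebra.
From HB Require Import structures.
From mathcomp Require Import ring.

(* A one-element global defensive alliance {v} forces v to be adjacent to every
   other vertex and to have degree at most 1, so the graph has one or two
   vertices, and it is partitionable exactly when it has two; hence (1) <-> (2).

   Let Z(R) = {0, a, b}.  If 2a <> 0 then b = -a, a^2 = 0 and 3a = 0.  Every r
   satisfies ra = ca with c in {0, 1, -1}, so r - c annihilates a and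
   r = c + da with d in {0, 1, -1}; whether 3 vanishes in R then separates
   Z_3[X]/(X^2) from Z_9.  If 2a = 0 then a + b is not a zero-divisor, which
   forces ab = 0, a^2 = a and b = 1 - a, so that R = {0, 1, a, 1 - a}. *)

Set Implicit Arguments.
Unset Strict Implicit.
Unset Printing Implicit Defensive.

Import GRing.Theory.

(** * Alliances of one vertex and partitions into global defensive alliances *)

Section Graph.
Variable G : sgraph.
Implicit Types (S : {set G}) (v w : G) (P : {set {set G}}).

Lemma gda_setT v : global_defensive_alliance [set: G].
Proof.
have nz : [set: G] != set0 by apply/set0Pn; exists v; rewrite inE.
rewrite /global_defensive_alliance /defensive_alliance /dominating nz /=.
apply/andP; split; apply/forallP => x; apply/implyP; last by rewrite !inE.
by move=> _; rewrite /deg_in setCT set0I cards0.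
Qed.

(** The only member of [[set v]] has no neighbour inside it, so the alliance inequality reads deg v
    <= 0 + 1. *)
Lemma gda_set1 v :
  global_defensive_alliance [set v] =
  (#|neighbours v| <= 1) && [forall w, (w != v) ==> adj v w].
Proof.
have nz : [set v] != set0 by apply/set0Pn; exists v; rewrite inE.
rewrite /global_defensive_alliance /defensive_alliance /dominating nz /=.
congr (_ && _).
  have nvv : v \notin neighbours v by rewrite inE adj_irrefl.
  have dout : deg_in (~: [set v]) v = #|neighbours v|.
    apply: eq_card => w; rewrite in_setI in_setC in_set1.
    by case: eqP => // ->; rewrite (negbTE nvv).
  have din : deg_in [set v] v = 0.
    apply/eqP; rewrite cards_eq0; apply/eqP/setP => w.
    by rewrite in_setI in_set1 in_set0; case: eqP => // ->; apply: negbTE.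
  apply/forall_inP/idP => [/(_ v (set11 v))|le1 x]; first by rewrite dout din.
  by rewrite in_set1 => /eqP ->; rewrite dout din.
apply: eq_forallb => w; rewrite in_setC in_set1; congr (_ ==> _).
rewrite /deg_in card_gt0; apply/set0Pn/idP => [[x]|avw].
  by rewrite !inE adj_sym => /andP[/eqP->].
by exists v; rewrite !inE eqxx adj_sym.
Qed.

Lemma gda_number_eq1 :
  gda_number G = 1 -> exists v, global_defensive_alliance [set v].
Proof.
have [V0|[v _]] := set_0Vmem [set: G].
  (* Without vertices the default value of the minimum is empty, so the number is 0 and not 1. *)
  rewrite /gda_number => card1.
  have := max_card (mem [arg min_(S < [set: G] | global_defensive_alliance S) #|S|]).
  by rewrite card1 -cardsT V0 cards0.
rewrite /gda_number; case: arg_minnP => [|S gdaS _ /eqP]; first exact: gda_setT v.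
by case/cards1P => w eqS; exists w; rewrite -eqS.
Qed.

Lemma card_gda_partition P : gda_partition P -> #|P| <= #|G|.
Proof.
case/andP => partP _; rewrite -cardsT (card_partition partP) -sum1_card.
apply: leq_sum => A AP; rewrite card_gt0; apply: contraTneq AP => ->.
by case/and3P: partP.
Qed.

Lemma gda_partition_set1 :
  (forall v, global_defensive_alliance [set v]) ->
  gda_partition [set [set v] | v : G].
Proof.
move=> gda1; apply/andP; split; last first.
  by apply/forall_inP => _ /imsetP[v _ ->]; apply: gda1.
apply/and3P; split.
- rewrite cover_imset; apply/eqP/setP => v; rewrite inE.
  by apply/bigcupP; exists v; rewrite ?inE.
- apply/trivIsetP => _ _ /imsetP[v _ ->] /imsetP[w _ ->] neq.
  by rewrite disjoints1 inE; apply: contraNneq neq => ->.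
- by apply/imsetP => -[v _ /setP/(_ v)]; rewrite !inE eqxx.
Qed.

Lemma gda_partitionable_card :
  gda_number G = 1 -> gda_partitionable G <-> #|G| = 2.
Proof.
case/gda_number_eq1 => v; rewrite gda_set1 => /andP[deg_v /forall_inP dom_v].
have card_G : #|G| <= 2.
  have -> : #|G| = #|v |: neighbours v|.
    rewrite -cardsT; apply: eq_card => w; rewrite !inE.
    by case: eqP => //= /eqP /dom_v ->.
  by rewrite cardsU1 (leq_add (leq_b1 _) deg_v).
split=> [|card2].
  rewrite /gda_partitionable /gda_partition_number => lt1.
  apply/eqP; rewrite eqn_leq card_G /=; apply: leq_trans lt1 _.
  by apply/bigmax_leqP => P; apply: card_gda_partition.
(* Conversely, with two vertices the partition into singletons has two blocks. *)
rewrite /gda_partitionable -card2 -(card_imset _ set1_inj).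
apply: leq_bigmax_cond; apply: gda_partition_set1 => w; rewrite gda_set1.
have card_C1 (u : G) : #|[set~ u]| = 1 by rewrite cardsC1 card2.
apply/andP; split.
  rewrite -(card_C1 w) subset_leq_card //; apply/subsetP => x.
  by rewrite !inE; apply: contraTneq => ->; rewrite adj_irrefl.
(* One of [w], [x] must be [v], since only one vertex differs from [v]. *)
apply/forall_inP => x neq_xw; have [eq_wv | neq_wv] := eqVneq w v.
  by rewrite eq_wv dom_v // -eq_wv.
have [-> | neq_xv] := eqVneq x v; first by rewrite adj_sym dom_v.
have /card_le1_eqP/(_ x w) := eq_leq (card_C1 v).
by rewrite !inE => /(_ neq_xv neq_wv) eq_xw; rewrite eq_xw eqxx in neq_xw.
Qed.

End Graph.

Local Open Scope ring_scope.

(** * Zero-divisors and vertices *)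

Lemma card_zero_divisor_graph (R : finComNzRingType) :
  #|zero_divisors R| = #|zero_divisor_graph R|.+1.
Proof.
rewrite (cardsD1 0) card_sig inE; case: existsP => // -[].
by exists 1; rewrite oner_eq0 mul0r eqxx.
Qed.

Lemma zero_divisorsP (R : finComNzRingType) (x : R) :
  reflect (exists2 y, y != 0 & x * y = 0) (x \in zero_divisors R).
Proof.
rewrite inE; apply: (iffP existsP) => [[y /andP[y0 /eqP xy0]]|[y y0 xy0]].
  by exists y.
by exists y; rewrite y0 xy0 eqxx.
Qed.

(** * Ring morphisms and isomorphisms *)

Lemma ring_isomorphic_sym (R S : nzRingType) :
  ring_isomorphic R S -> ring_isomorphic S R.
Proof.
case=> f [g fK gK].
pose gZ := GRing.isZmodMorphism.Build S R g (can2_zmod_morphism fK gK).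
pose gM := GRing.isMonoidMorphism.Build S R g (can2_monoid_morphism fK gK).
pose gR : {rmorphism S -> R} := HB.pack g gZ gM.
by exists gR; exists f.
Qed.

(** Surjectivity is stated with a boolean equality so that [xchoose] yields an actual inverse
    function. *)
Lemma rmorph_bij (R S : nzRingType) (f : {rmorphism R -> S}) :
  (forall x, f x = 0 -> x = 0) -> (forall y, exists x, f x == y) -> bijective f.
Proof.
move=> f_inj0 f_surj; have f_inj := raddf_inj f_inj0.
pose g y := xchoose (f_surj y).
have gK : cancel g f by move=> y; apply/eqP; exact: (xchooseP (f_surj y)).
by exists g => // x; apply: f_inj; apply: gK.
Qed.

(** The map m -> m 1 depends only on m mod n because n 1 = 0. The bound 1 < n makes ['Z_n] the ring
    of residues mod n. *)
Lemma natr_Zp_rmorphism (R : nzRingType) (n : nat) :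
    (1 < n)%N -> n%:R = 0 :> R ->
  exists f : {rmorphism 'Z_n -> R}, forall m : nat, f m%:R = m%:R.
Proof.
move=> n_gt1 n0; pose f (x : 'Z_n) : R := (x : nat)%:R.
have modE (m : nat) : (m %% n)%:R = m%:R :> R.
  by rewrite [in RHS](divn_eq m n) natrD natrM n0 mulr0 add0r.
have fE m : f m%:R = m%:R by rewrite /f val_Zp_nat.
have fD x y : f (x + y) = f x + f y.
  by rewrite -[x]natr_Zp -[y]natr_Zp -natrD !fE natrD.
have fZ : zmod_morphism f.
  by move=> x y; apply: (addIr (f y)); rewrite -fD !subrK.
have fM : monoid_morphism f.
  split=> [|x y]; first by rewrite -[1]/(1%:R) fE.
  by rewrite -[x]natr_Zp -[y]natr_Zp -natrM !fE natrM.
pose fZi := GRing.isZmodMorphism.Build _ _ f fZ.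
pose fMi := GRing.isMonoidMorphism.Build _ _ f fM.
by exists (HB.pack f fZi fMi : {rmorphism _ -> _}).
Qed.

(** * Descriptions of the three rings by one distinguished element *)

Definition digit (R : nzRingType) : pred R := [in [:: 0; 1; -1]].

(* Holds for the class of X in Z_3[X]/(X^2) and for 3 in Z_9. *)
Definition order9_square_zero (R : comNzRingType) (a : R) : Prop :=
  [/\ a != 0, a * a = 0, a *+ 3 = 0 &
      forall r, exists c d, [/\ digit c, digit d & r = c + d * a]].

(** Holds for (1, 0) in Z_2 x Z_2. *)
Definition order4_idempotent (R : comNzRingType) (e : R) : Prop :=
  [/\ e != 0, e != 1, e * e = e, 1 + 1 = 0 :> R &
      forall r, r \in [:: 0; 1; e; 1 - e]].

Lemma digitP (R : nzRingType) (c : R) :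
  digit c -> [\/ c = 0, c = 1 | c = -1].
Proof. by rewrite /digit inE !in_cons in_nil orbF => /or3P[] /eqP; constructor. Qed.

Lemma digit_rmorph (R S : nzRingType) (f : {rmorphism R -> S}) (c : R) :
  digit c -> digit (f c).
Proof.
by case/digitP => ->; rewrite ?rmorphN ?rmorph0 ?rmorph1 /digit !inE eqxx ?orbT.
Qed.

Lemma order9_opp_neq (R : comNzRingType) (a : R) :
  order9_square_zero a -> a != - a.
Proof.
case=> a0 _ a3 _; apply: contra a0 => /eqP aN.
have aD : a + a = 0 by rewrite {1}aN addNr.
have -> : a = a *+ 3 - (a + a) by ring.
by rewrite a3 aD subr0.
Qed.

(** * Counting zero-divisors from the descriptions *)

Lemma card_zero_divisors_order9 (R : finComNzRingType) (a : R) :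
  order9_square_zero a -> #|zero_divisors R| = 3%N.
Proof.
move=> sqa; have aN := order9_opp_neq sqa; case: sqa => a0 aa a3 dec.
suff -> : zero_divisors R = [set 0; a; - a].
  by rewrite setUC cardsU1 cards2 !inE oppr_eq0 ![_ == a]eq_sym (negbTE a0) (negbTE aN).
apply/setP => x; rewrite 2!in_setU !in_set1 -orbA; apply/zero_divisorsP/or3P => [[y y0 xy0]|].
  have [c [d [/digitP cP /digitP dP eq_x]]] := dec x.
  (* Multiplying x = c + da by its conjugate c - da leaves c^2, as a^2 = 0. Since c^2 = 1 for c = 1
     or -1, only c = 0 survives. *)
  have ccy : c * c * y = 0.
    have -> : c * c * y = (c - d * a) * (x * y) + d * d * y * (a * a).
      by rewrite eq_x; ring.
    by rewrite xy0 aa !mulr0 addr0.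
  case: cP eq_x ccy => -> eq_x; rewrite ?mulrNN ?mulr1 ?mul1r => ccy.
  - case: dP eq_x => ->; rewrite ?mul0r ?mul1r ?mulN1r ?add0r => ->;
      by [apply: Or31 | apply: Or32 | apply: Or33].
  - by rewrite ccy eqxx in y0.
  - by rewrite ccy eqxx in y0.
case=> /eqP ->; first by exists 1; rewrite ?oner_eq0 ?mul0r.
  by exists a.
by exists a; rewrite // mulNr aa oppr0.
Qed.

Lemma card_zero_divisors_order4 (R : finComNzRingType) (e : R) :
  order4_idempotent e -> #|zero_divisors R| = 3%N.
Proof.
case=> e0 e1 ee _ dec; have e'0 : 1 - e != 0 by rewrite subr_eq0 eq_sym.
have ee' : e * (1 - e) = 0 by rewrite mulrBr mulr1 ee subrr.
have eNe' : e != 1 - e by apply: contra e0 => /eqP eqe; rewrite -ee {2}eqe ee'.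
suff -> : zero_divisors R = [set 0; e; 1 - e].
  by rewrite setUC cardsU1 cards2 !inE ![_ == e]eq_sym (negbTE e0) (negbTE e'0)
             (negbTE eNe').
apply/setP => x; rewrite 2!in_setU !in_set1 -orbA.
apply/zero_divisorsP/or3P => [[y y0 xy0]|].
  have := dec x; rewrite !in_cons in_nil orbF => /or4P[] xE;
    try by [apply: Or31 | apply: Or32 | apply: Or33].
  by move: y0; rewrite -[y]mul1r -(eqP xE) xy0 eqxx.
case=> /eqP ->; first by exists 1; rewrite ?oner_eq0 ?mul0r.
  by exists (1 - e).
by exists e; rewrite // mulrC.
Qed.

(** Transport along an isomorphism: it suffices to check the description in the model ring. *)
Lemma order9_rmorph (R S : comNzRingType) (f : {rmorphism R -> S}) (a : R) :
  bijective f -> order9_square_zero a -> order9_square_zero (f a).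
Proof.
case=> g fK gK [a0 aa a3 dec]; split.
- by apply: contra a0 => /eqP fa0; rewrite -(fK a) fa0 -(rmorph0 f) fK.
- by rewrite -rmorphM aa rmorph0.
- by rewrite -rmorphMn a3 rmorph0.
move=> s; have [c [d [cP dP eq_gs]]] := dec (g s).
by exists (f c), (f d); rewrite !digit_rmorph // -rmorphM -rmorphD -eq_gs gK.
Qed.

Lemma order4_rmorph (R S : comNzRingType) (f : {rmorphism R -> S}) (e : R) :
  bijective f -> order4_idempotent e -> order4_idempotent (f e).
Proof.
move=> bij_f [e0 e1 ee two0 dec]; have f_inj := bij_inj bij_f.
case: bij_f => g _ gK; split.
- by rewrite -(rmorph0 f) (inj_eq f_inj).
- by rewrite -(rmorph1 f) (inj_eq f_inj).
- by rewrite -rmorphM ee.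
- by rewrite -(rmorph1 f) -rmorphD two0 rmorph0.
move=> s; rewrite -[s]gK; have := map_f f (dec (g s)).
by rewrite /= rmorphB rmorph0 rmorph1.
Qed.

(** * The three model rings satisfy the descriptions *)

Lemma order4_Z2xZ2 : order4_idempotent ((1, 0) : 'Z_2 * 'Z_2)%type.
Proof.
split; [by [] | by [] | | | ]; try by congr pair; apply/val_inj.
by move=> [[[|[]]//= ?] [[|[]]//= ?]]; apply/isT.
Qed.

Lemma order9_Z9 : order9_square_zero (3%:R : 'Z_9).
Proof.
split; [by [] | by apply/val_inj | by apply/val_inj | ].
move=> r; pose s : seq 'Z_9 := [:: 0; 1; -1].
(* A boolean search over the nine pairs of digits, decided by evaluation at each residue. *)
suff /hasP[c cP /hasP[d dP /eqP eq_r]] :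
    has (fun c => has (fun d => r == c + d * 3%:R) s) s by exists c, d.
by case: r => [[|[|[|[|[|[|[|[|[|m]]]]]]]]] lt_m].
Qed.

Lemma digit_Z3 (x : 'Z_3) : digit x.
Proof. by case: x => [[|[|[|m]]]]. Qed.

(** The quotient is formed modulo [mk_monic], which leaves nonconstant monic polynomials
    unchanged. *)
Lemma mk_monic_X2 (R : nzRingType) : mk_monic ('X^2 : {poly R}) = 'X^2.
Proof. exact: mk_monic_Xn. Qed.

Lemma qpolyX2E (R : comNzRingType) (p : {poly %/ ('X^2 : {poly R})}) :
  (p : {poly R}) = (p`_0)%:P + p`_1 *: 'X.
Proof.
have sz : (size p <= 2)%N.
  by rewrite -ltnS (leq_trans (size_mk_monic p)) // mk_monic_X2 size_polyXn.
apply/polyP => -[|[|i]]; rewrite coefD coefC coefZ coefX /= ?mulr0 ?mulr1 ?addr0 ?add0r //.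
by rewrite nth_default // (leq_trans sz).
Qed.

Lemma order9_polyX2 :
  order9_square_zero ('qX : {poly %/ ('X^2 : {poly 'Z_3})}).
Proof.
have qXE : ('qX : {poly %/ ('X^2 : {poly 'Z_3})}) = 'X :> {poly 'Z_3}.
  by rewrite qpolyXE ?size_polyXn ?monicXn.
split.
- by apply/eqP => /(congr1 val); rewrite [LHS]qXE => /eqP; rewrite polyX_eq0.
- rewrite -in_qpolyM -expr2; apply/val_inj => /=.
  by rewrite mk_monic_X2 Pdiv.Ring.rmodpp // /GRing.comm; ring.
- apply/val_inj; rewrite !mulrS mulr0n addr0 /=; apply/polyP => i.
  rewrite !coefD coef0; set x := _`_i.
  by case: x => [[|[|[|m]]] lt_m]; apply/val_inj.
(* The digits of r are its two coefficients: every element of Z_3 is a digit, and morphisms preserve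
   digits. *)
move=> r; exists (in_qpoly 'X^2 (r`_0)%:P), (in_qpoly 'X^2 (r`_1)%:P).
have dig (x : 'Z_3) : digit (in_qpoly 'X^2 x%:P).
  exact: (digit_rmorph (in_qpoly 'X^2) (digit_rmorph polyC (digit_Z3 x))).
split=> //; rewrite -in_qpolyM -in_qpolyD mul_polyC -qpolyX2E.
by apply/val_inj/esym/in_qpoly_small/size_mk_monic.
Qed.

(** * From the descriptions to isomorphisms with the model rings *)

Lemma order9_classification (R : comNzRingType) (a : R) :
  order9_square_zero a ->
  ring_isomorphic R 'Z_9 \/ ring_isomorphic R {poly %/ ('X^2 : {poly 'Z_3})}.
Proof.
case=> a0 aa a3 dec.
have [three0 | three_neq0] := eqVneq (3%:R : R) 0.
  right; apply: ring_isomorphic_sym.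
  have [phi _] := @natr_Zp_rmorphism R 3 isT three0.
  pose E (p : {poly 'Z_3}) := (map_poly phi p).[a].
  pose f (p : {poly %/ ('X^2 : {poly 'Z_3})}) := E p.
  (* Evaluation at a factors through the quotient because a^2 = 0. *)
  have E_rmodp p : E (Pdiv.Ring.rmodp p (mk_monic 'X^2)) = E p.
    rewrite mk_monic_X2.
    rewrite [in RHS](Pdiv.RingMonic.rdivp_eq (monicXn _ 2) p) /E.
    rewrite rmorphD rmorphM hornerD hornerM /= map_polyXn hornerXn (expr2 a) aa.
    by rewrite mulr0 add0r.
  have fZ : zmod_morphism f by move=> p q; rewrite /f /E !raddfB /= hornerD hornerN.
  have fM : monoid_morphism f.
    split=> [|p q]; first by rewrite /f /E /= rmorph1 hornerC.
    by rewrite /f poly_of_qpolyM E_rmodp /E rmorphM hornerM.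
  pose fZi := GRing.isZmodMorphism.Build _ _ f fZ.
  pose fMi := GRing.isMonoidMorphism.Build _ _ f fM.
  exists (HB.pack f fZi fMi : {rmorphism _ -> _}).
  have digit_phi c : digit c -> exists x, phi x = c.
    case/digitP => ->; first by exists 0; rewrite rmorph0.
      by exists 1; rewrite rmorph1.
    by exists (-1); rewrite rmorphN rmorph1.
  have phi_a x : phi x * a = 0 -> x = 0.
    case/digitP: (digit_Z3 x) => -> //; rewrite ?rmorphN rmorph1 ?mulN1r ?mul1r;
    by move/eqP; rewrite ?oppr_eq0 (negbTE a0).
  have EE x y : E (x%:P + y *: 'X) = phi x + phi y * a.
    by rewrite /E raddfD /= map_polyC map_polyZ map_polyX !hornerE.
  apply: rmorph_bij => [p|r] /=.
    rewrite /f qpolyX2E EE => fp0.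
    have p0 : p`_0 = 0.
      (* Multiplying by a kills the linear term and isolates the constant coefficient. *)
      apply: phi_a; move/(congr1 ( *%R^~ a)): fp0.
      by rewrite /= mulrDl -mulrA aa mulr0 addr0 mul0r.
    have p1 : p`_1 = 0 by apply: phi_a; rewrite p0 rmorph0 add0r in fp0.
    by apply/val_inj; rewrite /= qpolyX2E p0 p1 scale0r addr0.
  have [c [d [/digit_phi[x <-] /digit_phi[y <-] ->]]] := dec r.
  exists (in_qpoly 'X^2 (x%:P + y *: 'X)).
  by rewrite /f /= E_rmodp EE.
(* Write 3 = c + d a: multiplying by a gives c = 0, so 3 = a or 3 = - a. *)
left; apply: ring_isomorphic_sym.
have [c [d [/digitP cP dig_d eq3]]] := dec 3%:R.
have c0 : c = 0.
  have : c * a = 0.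
    have -> : c * a = 3%:R * a - d * (a * a) by rewrite eq3; ring.
    by rewrite aa mulr0 subr0 mulr_natl.
  case: cP => -> //; rewrite ?mulN1r ?mul1r => /eqP; 
  by rewrite ?oppr_eq0 (negbTE a0).
have dd : d * d = 1.
  case/digitP: dig_d eq3 => -> //; rewrite ?mulrNN ?mulr1 // c0 mul0r addr0.
  by move/eqP; rewrite (negbTE three_neq0).
have aE : a = d * 3%:R by rewrite eq3 c0 add0r mulrA dd mul1r.
(* 9 = (da)^2 and a^2 = 0. *)
have nine0 : 9%:R = 0 :> R.
  by rewrite (natrM _ 3 3) eq3 c0 !add0r mulrACA aa mulr0.
have [phi phiE] := @natr_Zp_rmorphism R 9 isT nine0.
have digit_phi e : digit e -> exists x, phi x = e.
  case/digitP => ->; first by exists 0; rewrite rmorph0.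
    by exists 1; rewrite rmorph1.
  by exists (-1); rewrite rmorphN rmorph1.
exists phi; apply: rmorph_bij => [x phix0|r].
  apply: contra_neq_eq three_neq0 => x0.
  (* Every nonzero residue mod 9 has 3 as a multiple, so a nonzero kernel would give 3 = 0 in R. *)
  have [y xy] : exists y, x * y = 3%:R.
    suff /hasP[y _ /eqP] : has (fun y => x * y == 3%:R) [:: 1; 2%:R; 3%:R; 6%:R].
      by exists y.
    by case: x {phix0} x0 => [[|[|[|[|[|[|[|[|[|m]]]]]]]]] lt_m].
  by rewrite -(phiE 3%N) -xy rmorphM phix0 mul0r.
have [c' [d' [/digit_phi[x <-] /digit_phi[y <-] ->]]] := dec r.
have [z dz] := digit_phi d dig_d.
(* a = 3d, and z is a preimage of d. *)
exists (x + y * (z * 3%:R)).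
by rewrite rmorphD (rmorphM phi y) (rmorphM phi z) dz (phiE 3%N) -aE.
Qed.

Lemma order4_classification (R : comNzRingType) (e : R) :
  order4_idempotent e -> ring_isomorphic R ('Z_2 * 'Z_2)%type.
Proof.
case=> e0 e1 ee two0 dec; apply: ring_isomorphic_sym.
have [phi _] := @natr_Zp_rmorphism R 2 isT two0.
have e'0 : 1 - e != 0 by rewrite subr_eq0 eq_sym.
have ee' : e * (1 - e) = 0 by rewrite mulrBr mulr1 ee subrr.
(* The splitting of R along the orthogonal idempotents e and 1 - e. *)
pose f (x : 'Z_2 * 'Z_2) := phi x.1 * e + phi x.2 * (1 - e).
have fZ : zmod_morphism f by move=> x y; rewrite /f !rmorphB /=; ring.
have fM : monoid_morphism f.
  split=> [|x y]; first by rewrite /f /= rmorph1; ring.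
  rewrite /f !rmorphM /=.
  have e'e' : (1 - e) * (1 - e) = 1 - e by rewrite mulrBl mul1r ee' subr0.
  set p := phi x.1; set q := phi x.2; set r := phi y.1; set s := phi y.2.
  have -> : (p * e + q * (1 - e)) * (r * e + s * (1 - e)) =
      p * r * (e * e) + (p * s + q * r) * (e * (1 - e))
      + q * s * ((1 - e) * (1 - e)) by ring.
  by rewrite ee ee' e'e' mulr0 addr0.
pose fZi := GRing.isZmodMorphism.Build _ _ f fZ.
pose fMi := GRing.isMonoidMorphism.Build _ _ f fM.
exists (HB.pack f fZi fMi : {rmorphism _ -> _}).
have phi_eq0 r x : r != 0 -> phi x * r = 0 -> x = 0.
  move=> r0; have [//|->] : x = 0 \/ x = 1.
    by case: x => [[|[|m]]] // lt_m; [left | right]; apply/val_inj.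
  by rewrite rmorph1 mul1r => /eqP; rewrite (negbTE r0).
apply: rmorph_bij => [[x y]|r] /=; rewrite /f /=.
  move=> fxy0; have x0 : x = 0.
    apply: (phi_eq0 e) => //; move/(congr1 ( *%R^~ e)): fxy0.
    by rewrite /= mulrDl -!mulrA ee (mulrC (1 - e)) ee' mulr0 addr0 mul0r.
  congr pair => //; apply: (phi_eq0 (1 - e)) => //.
  by rewrite x0 rmorph0 mul0r add0r in fxy0.
have := dec r; rewrite !in_cons in_nil orbF => /or4P[] /eqP->.
- by exists (0, 0); rewrite !rmorph0 !mul0r addr0.
- by exists (1, 1); rewrite !rmorph1 !mul1r addrC subrK.
- by exists (1, 0); rewrite rmorph1 rmorph0 mul0r mul1r addr0.
- by exists (0, 1); rewrite rmorph1 rmorph0 mul0r mul1r add0r.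
Qed.

(** * Rings with exactly three zero-divisors *)

Lemma card3_zero_divisors (R : finComNzRingType) :
  #|zero_divisors R| = 3%N ->
  (exists e : R, order4_idempotent e) \/ (exists a : R, order9_square_zero a).
Proof.
have zd0 : 0 \in zero_divisors R.
  by apply/zero_divisorsP; exists 1; rewrite ?oner_eq0 ?mul0r.
rewrite (cardsD1 0) zd0 add1n => -[/eqP/cards2P[a [b [aNb eqZ]]]].
have zdP x : x \in zero_divisors R -> [\/ x = 0, x = a | x = b].
  move=> zdx; have [|x0] := eqVneq x 0; first by constructor.
  have : x \in [set a; b] by rewrite -eqZ in_setD1 x0.
  by rewrite in_set2 => /orP[] /eqP; [constructor 2 | constructor 3].
(* The main tool below: exhibit a nonzero annihilator, then exclude all but one of the values 0, a,
   b. *)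
have zd_mul0 x y : y != 0 -> x * y = 0 -> [\/ x = 0, x = a | x = b].
  by move=> y0 xy0; apply: zdP; apply/zero_divisorsP; exists y.
have [/setD1P[a0 zda] /setD1P[b0 zdb]] :
  a \in zero_divisors R :\ 0 /\ b \in zero_divisors R :\ 0.
  by rewrite eqZ !in_set2 !eqxx orbT.
have [a2 | aNNa] := eqVneq (a + a) 0; last first.
  right; exists a.
  have bE : b = - a.
    case/zero_divisorsP: zda => y y0 ay0.
    have [] := zd_mul0 (- a) y y0; first by rewrite mulNr ay0 oppr0.
    - by move/eqP; rewrite oppr_eq0 (negbTE a0).
    - by move=> aE; rewrite -{1}aE addNr eqxx in aNNa.
    - by [].
  have aa : a * a = 0.
    case/zero_divisorsP: zda => y y0 ay0; move: (ay0) (ay0) y0.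
    rewrite mulrC => ya0 _ y0; case: (zd_mul0 y a a0 ya0) => yE.
    - by rewrite yE eqxx in y0.
    - by rewrite -{2}yE.
    - by rewrite -[RHS]oppr0 -ay0 yE bE mulrN opprK.
  have za x : x * a = 0 -> exists2 d, digit d & x = d * a.
    case/(zd_mul0 _ _ a0) => ->; first by exists 0; rewrite ?mul0r ?/digit ?inE ?eqxx.
      by exists 1; rewrite ?mul1r // /digit !inE eqxx orbT.
    by exists (-1); rewrite ?mulN1r // /digit !inE eqxx !orbT.
  have aaa x : x * a * a = 0 by rewrite -mulrA aa mulr0.
  split=> //.
    (* 2a is killed by a and is neither 0 nor a, so 2a = b = -a. *)
    have [] := zd_mul0 (a + a) a a0; first by rewrite mulrDl aa addr0.
    - by move/eqP; rewrite (negbTE aNNa).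
    - by move/(canRL (addrK a)); rewrite subrr => /eqP; rewrite (negbTE a0).
    - by rewrite bE => aaN; rewrite !mulrS mulr0n addr0 aaN subrr.
  move=> r; have [c digc rcE] := za _ (aaa r).
  have [|d digd rE] := za (r - c); first by rewrite mulrBl rcE subrr.
  by exists c, d; split=> //; rewrite -rE addrC subrK.
left.
have ba_neq0 : b != - a.
  by apply: contra aNb => /eqP ->; rewrite eq_sym -subr_eq0 -opprD a2 oppr0.
(* a + b is none of 0, a, b, hence not a zero-divisor. *)
have sum_reg y : y != 0 -> (a + b) * y <> 0.
  move=> y0 /(zd_mul0 _ _ y0)[] /eqP.
  - by rewrite addrC addr_eq0 (negbTE ba_neq0).
  - by rewrite -subr_eq0 addrC addKr (negbTE b0).
  - by rewrite -subr_eq0 addrK (negbTE a0).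
have b2 : b + b = 0.
  case/zero_divisorsP: zdb => y y0 by0.
  have [] := zd_mul0 (- b) y y0; first by rewrite mulNr by0 oppr0.
  - by move/eqP; rewrite oppr_eq0 (negbTE b0).
  - by move=> /(canRL opprK)/eqP; rewrite (negbTE ba_neq0).
  - by move=> bE; rewrite -{1}bE addNr.
have ab : a * b = 0.
  case/zero_divisorsP: (zda) => y y0 ay0; move: (ay0); rewrite mulrC.
  case/(zd_mul0 _ _ a0) => yE; [by rewrite yE eqxx in y0| |by rewrite -yE].
  (* Here a^2 = 0, so ab is killed by a. If ab = a, a nonzero annihilator of b is a or b, and either
     gives ab = 0; if ab = b, then ab = a(ab) = 0. *)
  rewrite {}yE in ay0.
  have [|//||abE] := zd_mul0 (a * b) a a0; first by rewrite mulrAC ay0 mul0r.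
    move=> abE; case/zero_divisorsP: zdb => z z0 bz0; move: (bz0); rewrite mulrC.
    case/(zd_mul0 _ _ b0) => zE; first by rewrite zE eqxx in z0.
      by rewrite mulrC -zE.
    by rewrite -abE -mulrA -{2}zE bz0 mulr0.
  by rewrite abE -abE -[X in a * X]abE mulrA ay0 mul0r.
have ba : b * a = 0 by rewrite mulrC.
(* a^2 is killed by b. If a^2 = 0, then a + b kills a; if a^2 = b, then b^2 = 0 and a + b kills
   b. *)
have aa : a * a = a.
  have [|aa0|//|aaE] := zd_mul0 (a * a) b b0; first by rewrite -mulrA ab mulr0.
    by case: (sum_reg a a0); rewrite mulrDl aa0 ba addr0.
  by case: (sum_reg b b0); rewrite mulrDl ab add0r -{1}aaE -mulrA ab mulr0.
have a'E : 1 - a = b.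
  have [|a'0|a'a|//] := zd_mul0 (1 - a) a a0; first by rewrite mulrBl mul1r aa subrr.
    by move: b0; rewrite -[b]mul1r -[1](subrK a) a'0 add0r ab eqxx.
  by move: a0; rewrite -aa -{1}a'a mulrBl mul1r aa subrr eqxx.
have one : 1 = a + b by rewrite -a'E addrC subrK.
have ra r : r * a = 0 \/ r * a = a.
  have [||| raE] := zd_mul0 (r * a) b b0; [by rewrite -mulrA ab mulr0 | by left | by right|].
  by move: b0; rewrite -raE -aa mulrA raE ba eqxx.
have rb r : r * b = 0 \/ r * b = b.
  have [|| rbE|] := zd_mul0 (r * b) a a0; [by rewrite -mulrA ba mulr0 | by left | | by right].
  by move: a0; rewrite -aa -{1}rbE -mulrA ba mulr0 eqxx.
exists a; split=> //.
- by apply: contra b0 => /eqP a1; rewrite -a'E a1 subrr.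
- by rewrite one addrACA a2 b2 addr0.
(* r = ra + rb with ra in {0, a} and rb in {0, b}. *)
move=> r; rewrite a'E one -[r]mulr1 {1}one mulrDr !in_cons.
by case: (ra r) => ->; case: (rb r) => ->; rewrite ?addr0 ?add0r eqxx ?orbT.
Qed.

(** * The equivalences *)

Theorem theorem3p19 (R : finComNzRingType)
    (hR : gda_number (zero_divisor_graph R) = 1%N) :
  (gda_partitionable (zero_divisor_graph R) <-> #|zero_divisors R| = 3%N) /\
  (#|zero_divisors R| = 3%N <->
     (ring_isomorphic R ('Z_2 * 'Z_2)%type \/
      ring_isomorphic R 'Z_9 \/
      ring_isomorphic R {poly %/ ('X^2 : {poly 'Z_3})})).
Proof.
split.
  (* Two vertices mean three zero-divisors, since 0 is not a vertex. *)
  rewrite card_zero_divisor_graph; apply: iff_trans (gda_partitionable_card hR) _.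
  by split=> [-> | []].
split=> [/card3_zero_divisors[[e /order4_classification]|[a /order9_classification]]|].
- by left.
- by right.
case=> [/ring_isomorphic_sym[f bij_f]|[]/ring_isomorphic_sym[f bij_f]].
- exact: card_zero_divisors_order4 (order4_rmorph bij_f order4_Z2xZ2).
- exact: card_zero_divisors_order9 (order9_rmorph bij_f order9_Z9).
- exact: card_zero_divisors_order9 (order9_rmorph bij_f order9_polyX2).
Qed.
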